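(* Let $X$ be a block spindle having a one-element block $\{b\}$, and let $\{X_i\}_{i\in I}$ be the family of all the other blocks, with block functions $f_i\colon X_i\to X_i$. Put $X_i^+:=X_i\sqcup\{b\}\subset X$, a subspindle of $X$. Then $$H_1(X)\cong F\oplus\bigoplus_{i\in I}H_1(X_i^+),$$ where $F$ is a free abelian group of rank $\sum_{i\neq j}\mathrm{orb}(f_i)\,|X_j|$ (the sum over ordered pairs $i\ne j$ in $I$). In particular, every finite abelian group can be realized as the torsion subgroup of $H_1(X)$ for some spindle $X$.
   Context: A spindle $(X,\star)$ is a set with a binary operation that is idempotent ($x\star x=x$) and self-distributive ($(x\star y)\star z=(x\star z)\star(y\star z)$). Its one-term distributive chain complex $C(X)$ has $C_n(X)=\mathbb{Z}X^{n+1}$, the free abelian group on sequences $(x_0,\dots,x_n)$ ($n\geqslant 0$), with $\partial_n=\sum_{i=0}^n(-1)^id^i$ where $d^0(x_0,\dots,x_n)=(x_1,\dots,x_n)$ and $d^i(x_0,\dots,x_n)=(x_0\star x_i,\dots,x_{i-1}\star x_i,x_{i+1},\dots,x_n)$ for $i\geqslant1$; the differential vanishes on $C_0(X)$. $H_n(X)$ denotes its homology. Block spindle: given a family of sets $\{X_j\}$ (not necessarily finite sets, nor a finite family) and functions $f_j\colon X_j\to X_j$, the block spindle is the disjoint union $X=\coprod_j X_j$ with the product, for $x\in X_i$ and $y\in X_j$, given by $x\star y=y$ if $i=j$ and $x\star y=f_j(y)$ if $i\neq j$. The $X_j$ are the blocks and the $f_j$ the block functions. $\mathrm{orb}(f_i)$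 is the number of connected components of the graph with vertex set $X_i$ and edges $x\to f_i(x)$ (cardinalities may be infinite). *)

(* Defs.v *)
(* Mathematical Components; sets are choiceTypes, and classical reasoning
   comes from mathcomp.classical.boolp. *)
From HB Require Import structures.
From mathcomp Require Import freeg.
From mathcomp Require Import all_boot all_algebra.
From mathcomp Require Import boolp classical_sets cardinality.
From Stdlib Require Import Relation_Operators.

Set Implicit Arguments.
Unset Strict Implicit.
Unset Printing Implicit Defensive.

Import GRing.Theory.
Local Open Scope ring_scope.
Local Open Scope quotient_scope.

HB.mixin Record isSpindle T of Choice T := {
  star : T -> T -> T;
  starxx : idempotent_op star;
  starD : left_distributive star star
}.

#[short(type="spindleType")]
HB.structure Definition Spindle := {T of isSpindle T & Choice T}.

Section Homology.
Variable X : spindleType.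

Definition chain (n : nat) : zmodType := {freeg n.+1.-tuple X}.

(* [lift i k] is k for k < i and k + 1 otherwise, so that [face i x] is
   (x_0 * x_i, ..., x_{i-1} * x_i, x_{i+1}, ..., x_{n+1}); for i = 0 it is
   (x_1, ..., x_{n+1}). *)
Definition face n (i : 'I_n.+2) (x : n.+2.-tuple X) : n.+1.-tuple X :=
  [tuple if (k < i)%N then star (tnth x (lift i k)) (tnth x i)
         else tnth x (lift i k) | k < n.+1].

Definition boundary n : chain n.+1 -> chain n :=
  fglift (fun x : n.+2.-tuple X =>
    \sum_(i < n.+2) (-1) ^+ i *: (<< face i x >> : {freeg n.+1.-tuple X})).

Lemma boundary_is_zmod_morphism n : zmod_morphism (@boundary n).
Proof. exact: lift_is_additive. Qed.

HB.instance Definition _ n :=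
  GRing.isZmodMorphism.Build (chain n.+1) (chain n) (@boundary n)
    (@boundary_is_zmod_morphism n).

Definition is_cycle n : pred (chain n) :=
  match n with
  | 0 => fun _ => true
  | m.+1 => fun z => boundary z == 0
  end.

Lemma is_cycle_zmod_closed n : zmod_closed (@is_cycle n).
Proof.
case: n => [|n]; split => //; first by apply/eqP; exact: raddf0.
move=> x y /eqP x0 /eqP y0; apply/eqP.
by rewrite raddfB /= x0 y0 subr0.
Qed.

HB.instance Definition _ n :=
  GRing.isZmodClosed.Build (chain n) (@is_cycle n) (@is_cycle_zmod_closed n).

Definition cycles n := {z : chain n | is_cycle z}.
HB.instance Definition _ n := SubChoice.on (cycles n).
HB.instance Definition _ n := [SubChoice_isSubZmodule of cycles n by <:].

Definition is_boundary n : pred (cycles n) :=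
  fun z => `[< exists c : chain n.+1, boundary c = val z >].

Lemma is_boundary_zmod_closed n : zmod_closed (@is_boundary n).
Proof.
split; first by apply/asboolP; exists 0; rewrite !raddf0.
move=> x y /asboolP[c cx] /asboolP[d dy]; apply/asboolP.
by exists (c - d); rewrite !raddfB /= cx dy.
Qed.

HB.instance Definition _ n :=
  GRing.isZmodClosed.Build (cycles n) (@is_boundary n)
    (@is_boundary_zmod_closed n).

Definition homology (n : nat) : zmodType :=
  Quotient.quot (GRing.ZmodClosed.clone (cycles n) (@is_boundary n) _).

End Homology.

Arguments homology X n : clear implicits.

(* The carrier does not depend on f; the argument selects the operation. *)
Definition block_spindle (J : choiceType) (X : J -> choiceType)
    (f : forall j, X j -> X j) : Type := {j : J & X j}.

Section BlockSpindle.
Variables (J : choiceType) (X : J -> choiceType) (f : forall j, X j -> X j).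

Local Notation block_spindle := (block_spindle f).
HB.instance Definition _ := Choice.copy block_spindle {j : J & X j}.

Definition block_star (x y : block_spindle) : block_spindle :=
  if tag x == tag y then y else Tagged X (f (tagged y)).

Lemma tag_block_star x y : tag (block_star x y) = tag y.
Proof. by rewrite /block_star; case: ifP. Qed.

Lemma block_starxx : idempotent_op block_star.
Proof. by move=> x; rewrite /block_star eqxx. Qed.

Lemma block_starD : left_distributive block_star block_star.
Proof.
have starE u v w : tag u = tag v -> block_star u w = block_star v w.
  by rewrite /block_star => ->.
move=> x y z; rewrite (starE _ y) ?tag_block_star //.
by rewrite [RHS](starE _ (block_star y z)) ?tag_block_star // block_starxx.
Qed.

HB.instance Definition _ :=
  isSpindle.Build block_spindle block_starxx block_starD.

(* The subspindle of all blocks whose index satisfies P. *)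
Definition blocks (P : pred J) : Type := {x : block_spindle | P (tag x)}.
HB.instance Definition _ P := SubChoice.on (blocks P).

Lemma blocks_subproof P (x y : blocks P) : P (tag (star (val x) (val y))).
Proof. by rewrite tag_block_star (valP y). Qed.

Definition blocks_star P (x y : blocks P) : blocks P :=
  Sub (star (val x) (val y)) (blocks_subproof x y).

Lemma blocks_starxx P : idempotent_op (@blocks_star P).
Proof. by move=> x; apply/val_inj; exact: starxx. Qed.

Lemma blocks_starD P : left_distributive (@blocks_star P) (@blocks_star P).
Proof. by move=> x y z; apply/val_inj; exact: starD. Qed.

HB.instance Definition _ P :=
  isSpindle.Build (blocks P) (@blocks_starxx P) (@blocks_starD P).

End BlockSpindle.

Section Components.
Variables (T : choiceType) (f : T -> T).

Definition connected : rel T :=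
  fun x y => `[< clos_refl_sym_trans T (fun u v => v = f u) x y >].

Lemma connected_equiv : equiv_class_of connected.
Proof.
split=> [x|x y|y x z]; first by apply/asboolP; exact: rst_refl.
  by apply/asboolP/asboolP => ?; exact: rst_sym.
by move=> /asboolP ? /asboolP ?; apply/asboolP; apply: rst_trans; eassumption.
Qed.

Canonical connected_equiv_rel := EquivRelPack connected_equiv.
Canonical connected_encModRel := defaultEncModRel connected.

(* The set of connected components; its cardinality is orb(f). *)
Definition components : choiceType := {eq_quot connected}.

End Components.

Section DirectSum.
Variables (I : Type) (V : I -> zmodType).

Definition dprod : Type := forall i, V i.
HB.instance Definition _ := gen_eqMixin dprod.
HB.instance Definition _ := gen_choiceMixin dprod.

Definition dprod_zero : dprod := fun=> 0.
Definition dprod_opp (u : dprod) : dprod := fun i => - u i.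
Definition dprod_add (u v : dprod) : dprod := fun i => u i + v i.

Lemma dprod_addA : associative dprod_add.
Proof. by move=> u v w; apply: functional_extensionality_dep => i; exact: addrA. Qed.
Lemma dprod_addC : commutative dprod_add.
Proof. by move=> u v; apply: functional_extensionality_dep => i; exact: addrC. Qed.
Lemma dprod_add0 : left_id dprod_zero dprod_add.
Proof. by move=> u; apply: functional_extensionality_dep => i; exact: add0r. Qed.
Lemma dprod_addN : left_inverse dprod_zero dprod_opp dprod_add.
Proof. by move=> u; apply: functional_extensionality_dep => i; exact: addNr. Qed.

HB.instance Definition _ :=
  GRing.isZmodule.Build dprod dprod_addA dprod_addC dprod_add0 dprod_addN.

Definition finsupp : pred dprod :=
  fun u => `[< finite_set [set i | u i <> 0] >].

Lemma finsupp_zmod_closed : zmod_closed finsupp.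
Proof.
split.
  apply/asboolP; rewrite (_ : mkset _ = set0) //.
  by apply/seteqP; split=> // i /=; apply.
move=> u v /asboolP fu /asboolP fv; apply/asboolP.
apply: sub_finite_set (_ : finite_set ([set i | u i <> 0] `|` [set i | v i <> 0])%classic).
  move=> i /= uv; case: (pselect (u i = 0)) => ui; last by left.
  by right=> vi; apply: uv; rewrite -[LHS]/(u i - v i) ui vi subr0.
by rewrite finite_setU.
Qed.

HB.instance Definition _ := GRing.isZmodClosed.Build dprod finsupp finsupp_zmod_closed.

Definition dsum_type := {u : dprod | finsupp u}.
HB.instance Definition _ := SubChoice.on dsum_type.
HB.instance Definition _ := [SubChoice_isSubZmodule of dsum_type by <:].

Definition dsum : zmodType := dsum_type.

End DirectSum.

Section Torsion.
Variable A : zmodType.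

Definition is_torsion : pred A :=
  fun x => `[< exists2 n : nat, (0 < n)%N & x *+ n = 0 >].

Lemma is_torsion_zmod_closed : zmod_closed is_torsion.
Proof.
split; first by apply/asboolP; exists 1%N.
move=> x y /asboolP[m m0 xm] /asboolP[n n0 yn]; apply/asboolP.
exists (m * n)%N; first by rewrite muln_gt0 m0.
by rewrite mulrnBl mulrnA xm mul0rn sub0r mulnC mulrnA yn mul0rn oppr0.
Qed.

HB.instance Definition _ :=
  GRing.isZmodClosed.Build A is_torsion is_torsion_zmod_closed.

Definition torsion_type := {x : A | is_torsion x}.
HB.instance Definition _ := SubChoice.on torsion_type.
HB.instance Definition _ := [SubChoice_isSubZmodule of torsion_type by <:].

Definition torsion : zmodType := torsion_type.

End Torsion.

Definition zmod_isomorphic (A B : zmodType) : Prop :=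
  exists phi : {additive A -> B}, bijective phi.

(* The disjoint union, over ordered pairs i <> j, of the products of the set
   of components of f_i with X_j: its cardinality is
   \sum_(i <> j) orb(f_i) |X_j|, whether finite or infinite. *)
Definition rank_index (I : choiceType) (X : I -> choiceType)
    (f : forall i, X i -> X i) : choiceType :=
  {p : {p : I * I | p.1 != p.2} &
     (components (@f (val p).1) * X (val p).2)%type}.

(* Main.v *)
From HB Require Import structures.
From mathcomp Require Import all_boot all_algebra.
From mathcomp Require Import fingroup gproduct cyclic abelian.
Require Import Defs.
From mathcomp Require Import generic_quotient freeg.
From mathcomp Require Import boolp classical_sets cardinality.
From Stdlib Require Import Relation_Operators.

Set Implicit Arguments.
Unset Strict Implicit.
Unset Printing Implicit Defensive.

(** In degree one everything follows from a computation of chains modulo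
    boundaries.  Write [x, y] for the class of a generator (x, y) modulo the
    boundaries of 2-chains, let b be the point of the one-element block, and
    write f for all the block functions.  The generators of the 2-chains give
    - [x, x] = 0, from (x, x, x);
    - [x, f x] = 0, from (x, b, x);
    - [f x, y] = [x, y] if x and y lie in different blocks, from (b, x, y);
    - [f x, y] = [x, y] + [f y, y] if they lie in the same block, again from
      (b, x, y).

    Decomposition.  Sending to b every block other than X_i and {b} is a
    spindle morphism, because a product x * y lies in the block of y and depends
    on x only through the block of x; so X_i^+ is a retract of X and
    H_1(X) maps to every H_1(X_i^+).  What these retractions miss are the
    generators (x, y) with x in X_i, y in X_j and i <> j.  By the third relation
    [x, y] depends on x only through its component, whence a homomorphism from
    H_1(X) to the free group F on the triples formed of a pair i <> j, a
    component of f_i and a point of X_j ([crossing_part]).  The cycles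
    (x, y) - (b, y) - (x, b) split it and are killed by the retractions.  On
    each generator one checks that the identity, modulo boundaries, is the sum
    of the crossing part and of the retractions followed by the inclusions
    ([class_decomposition]); only finitely many blocks meet a given cycle, so
    this yields the isomorphism with F (+) (+)_i H_1(X_i^+).

    Torsion.  A block consisting of a cycle of length n and one more point t
    attached to it by t -> u contributes exactly Z/n.  Indeed the fourth
    relation says that [x, t] grows by the class [u, t] each time x advances by
    one step, so [x, t] = k [u, t] at distance k from t, and closing the
    cycle gives n [u, t] = 0 ([class_loop_torsion]).  Inside the block
    [x, y] vanishes as soon as y has a preimage ([class_edge_image]), and pairs
    with entries in different blocks span a free group.  A
    finite abelian group A is a direct sum of cyclic groups; taking one such
    block for each summand, the winding numbers along the cycles define a
    homomorphism from H_1 to A which is bijective on the torsion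
    ([torsion_homology]). *)

Import GRing.Theory Num.Theory.
Local Open Scope ring_scope.
Local Open Scope quotient_scope.

(** * Free abelian groups *)

Section FreeGroup.
Variables (K : choiceType) (V : zmodType).

Lemma eq_additive_dom (g1 g2 : {additive {freeg K} -> V}) z :
  (forall x, x \in dom z -> g1 << x >> = g2 << x >>) -> g1 z = g2 z.
Proof.
move=> eqg; rewrite -[z]freeg_sumE !raddf_sum /=.
apply: eq_big_seq => x zx.
by rewrite -[coeff x z]intz -freegU_mulz !raddfMz eqg.
Qed.

Lemma eq_additive (g1 g2 : {additive {freeg K} -> V}) :
  (forall x, g1 << x >> = g2 << x >>) -> g1 =1 g2.
Proof. by move=> eqg z; apply: eq_additive_dom. Qed.

End FreeGroup.

Lemma freeg_torsion_free (K : choiceType) (z : {freeg K}) n :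
  (0 < n)%N -> z *+ n = 0 -> z = 0.
Proof.
move=> n0 zn; apply/eqP/freeg_eqP => x; rewrite coeff0.
apply/eqP; have /eqP := congr1 (coeff x) zn.
by rewrite coeff0 coeffMn mulrn_eq0 eqn0Ngt n0.
Qed.

Section Lift.
Variables (K : choiceType) (M : lmodType int) (u : K -> M).
HB.instance Definition _ :=
  GRing.isZmodMorphism.Build {freeg K} M (fglift u) (lift_is_additive u).
Lemma fgliftU x : fglift u << x >> = u x.
Proof. by rewrite liftU scale1r. Qed.
End Lift.

(** * Homology as a quotient *)

Section Quotients.
Variables (X : spindleType) (n : nat).

Definition bounds : pred (chain X n) :=
  fun z => `[< exists c : chain X n.+1, boundary c = z >].

Lemma bounds_zmod_closed : zmod_closed bounds.
Proof.
split; first by apply/asboolP; exists 0; rewrite raddf0.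
move=> x y /asboolP[c cx] /asboolP[d dy]; apply/asboolP.
by exists (c - d); rewrite raddfB /= cx dy.
Qed.

HB.instance Definition _ :=
  GRing.isZmodClosed.Build (chain X n) bounds bounds_zmod_closed.

(** All chains, not only the cycles, modulo boundaries: on this group identities
    between homology classes can be checked on the generators, which are not
    cycles in general. *)
Definition coker : zmodType :=
  Quotient.quot (GRing.ZmodClosed.clone (chain X n) bounds _).

Definition chain_class (z : chain X n) : coker := \pi z.

Lemma class_is_zmod_morphism : zmod_morphism chain_class.
Proof. by move=> x y; rewrite /chain_class !piE. Qed.
HB.instance Definition _ :=
  GRing.isZmodMorphism.Build (chain X n) coker chain_class
    class_is_zmod_morphism.

Lemma class_eq0P z : chain_class z = 0 <-> exists c, boundary c = z.
Proof.
rewrite -(raddf0 chain_class) /chain_class; split.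
  by move/eqP; rewrite -Quotient.idealrBE subr0 => /asboolP.
by move=> cz; apply/eqP; rewrite -Quotient.idealrBE subr0; apply/asboolP.
Qed.

Lemma class_boundary c : chain_class (boundary c) = 0.
Proof. by apply/class_eq0P; exists c. Qed.

Definition homology_class (z : cycles X n) : homology X n := \pi z.

Lemma homology_class_is_zmod_morphism : zmod_morphism homology_class.
Proof. by move=> x y; rewrite /homology_class !piE. Qed.
HB.instance Definition _ :=
  GRing.isZmodMorphism.Build (cycles X n) (homology X n) homology_class
    homology_class_is_zmod_morphism.

Lemma homology_class_surj (h : homology X n) : exists z, h = homology_class z.
Proof. by exists (repr h); rewrite /homology_class reprK. Qed.

Lemma homology_class_eq0P (z : cycles X n) :
  homology_class z = 0 <-> chain_class (val z) = 0.
Proof.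
have bE : (homology_class z == 0) = is_boundary z.
  by rewrite -(raddf0 homology_class) /homology_class -Quotient.idealrBE subr0.
split=> [/eqP|/class_eq0P zb]; first by rewrite bE => /asboolP/class_eq0P.
by apply/eqP; rewrite bE; apply/asboolP.
Qed.

Lemma homology_lift (V : zmodType) (g : {additive cycles X n -> V}) :
  (forall z, chain_class (val z) = 0 -> g z = 0) ->
  exists h : {additive homology X n -> V}, forall z, h (homology_class z) = g z.
Proof.
move=> g0.
have gE z w : homology_class z = homology_class w -> g z = g w.
  move/eqP; rewrite -subr_eq0 -raddfB => /eqP/homology_class_eq0P/g0/eqP.
  by rewrite raddfB subr_eq0 => /eqP.
pose h (x : homology X n) : V := g (repr x).
have hE z : h (homology_class z) = g z.
  by apply: gE; rewrite /homology_class reprK.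
have h_additive : zmod_morphism h.
  move=> x y; have [z ->] := homology_class_surj x.
  have [w ->] := homology_class_surj y.
  by rewrite -raddfB !hE raddfB.
pose hA := GRing.isZmodMorphism.Build _ _ h h_additive.
by exists (HB.pack_for {additive homology X n -> V} h hA).
Qed.

End Quotients.

Lemma zmod_isomorphic_of_bij (A B : zmodType) (g : {additive A -> B}) :
  (forall x, g x = 0 -> x = 0) -> (forall y, exists x, g x = y) ->
  zmod_isomorphic A B /\ zmod_isomorphic B A.
Proof.
move=> g0 gs.
have [h hK] := choice gs.
have gI : injective g.
  move=> x y /eqP; rewrite -subr_eq0 -raddfB => /eqP/g0/eqP.
  by rewrite subr_eq0 => /eqP.
have Kh : cancel g h by move=> x; apply: gI; rewrite hK.
have h_additive : zmod_morphism h by move=> x y; apply: gI; rewrite raddfB !hK.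
split; first by exists g; exists h.
pose hA := GRing.isZmodMorphism.Build _ _ h h_additive.
by exists (HB.pack_for {additive B -> A} h hA); exists g.
Qed.

(** * Functoriality *)

Section ChainMap.
Variables (X Y : spindleType) (u : X -> Y).

Definition chain_map n : chain X n -> chain Y n :=
  fglift (fun t : n.+1.-tuple X =>
    (<< map_tuple u t >> : {freeg n.+1.-tuple Y})).

HB.instance Definition _ n :=
  GRing.isZmodMorphism.Build (chain X n) (chain Y n) (@chain_map n)
   (lift_is_additive _).

Lemma chain_mapU n (t : n.+1.-tuple X) :
  chain_map << t >> = << map_tuple u t >>.
Proof. exact: fgliftU. Qed.

Hypothesis uM : {morph u : x y / star x y}.

Lemma face_map n (i : 'I_n.+2) (t : n.+2.-tuple X) :
  face i (map_tuple u t) = map_tuple u (face i t).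
Proof.
apply: eq_from_tnth => k; rewrite [RHS]tnth_map !tnth_mktuple !tnth_map -uM.
by case: ifP.
Qed.

Lemma boundary_chain_map n (c : chain X n.+1) :
  boundary (chain_map c) = chain_map (boundary c).
Proof.
have := @eq_additive _ _ (boundary (n:=n) \o chain_map (n:=n.+1))
  (chain_map (n:=n) \o boundary (n:=n)).
apply=> t /=.
rewrite chain_mapU /boundary !fgliftU raddf_sum /=; apply: eq_bigr => i _.
rewrite face_map -chain_mapU.
by rewrite -[_ ^+ i]intz !scaler_int raddfMz.
Qed.

Lemma chain_map_cycle n (z : chain X n) : is_cycle z -> is_cycle (chain_map z).
Proof.
case: n z => //= n z /eqP bz; apply/eqP.
by rewrite boundary_chain_map bz raddf0.
Qed.

Definition cycles_map n (z : cycles X n) : cycles Y n :=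
  Sub (chain_map (val z)) (chain_map_cycle (valP z)).

Lemma cycles_map_is_zmod_morphism n : zmod_morphism (@cycles_map n).
Proof. by move=> x y; apply: val_inj; rewrite /= !raddfB. Qed.

HB.instance Definition _ n :=
  GRing.isZmodMorphism.Build (cycles X n) (cycles Y n) (@cycles_map n)
   (@cycles_map_is_zmod_morphism n).

Lemma class_chain_map n (z : chain X n) :
  chain_class z = 0 -> chain_class (chain_map z) = 0.
Proof.
by move=> /class_eq0P[c <-]; rewrite -boundary_chain_map class_boundary.
Qed.

End ChainMap.

(** * Low degrees *)

Section DegreeOne.
Variable X : spindleType.

Definition pt (x : X) : chain X 0 := << [tuple x] >>.
Definition edge (x y : X) : chain X 1 := << [tuple x; y] >>.
Definition tri (x y z : X) : chain X 2 := << [tuple x; y; z] >>.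

Lemma tuple2E (t : 2.-tuple X) : t = [tuple tnth t ord0; tnth t ord_max].
Proof. by case: t => [[|x [|y []]] //= st]; apply: val_inj. Qed.

Lemma tuple3E (t : 3.-tuple X) :
  t = [tuple tnth t ord0; tnth t (inord 1); tnth t ord_max].
Proof.
case: t => [[|x [|y [|z []]]] //= st]; apply: val_inj => /=.
by rewrite !(tnth_nth x) /= inordK.
Qed.

Lemma boundary_edge x y : boundary (edge x y) = pt y - pt (star x y).
Proof.
rewrite /boundary fgliftU !big_ord_recl big_ord0 addr0 expr0 scale1r.
rewrite expr1 scaleN1r.
congr (<< _ >> - << _ >>); apply: eq_from_tnth => k;
  by rewrite tnth_mktuple !(tnth_nth x) /= (ord1 k).
Qed.

Lemma boundary_tri x y z :
  boundary (tri x y z) =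
  edge y z - edge (star x y) z + edge (star x z) (star y z).
Proof.
rewrite /boundary fgliftU !big_ord_recl big_ord0 addr0 expr0 scale1r.
rewrite expr1 scaleN1r expr2 mulN1r opprK scale1r addrA.
congr (<< _ >> - << _ >> + << _ >>); apply: eq_from_tnth => k;
  by rewrite tnth_mktuple !(tnth_nth x) /=; case: k => [[|[|k]]] /=.
Qed.

Lemma class_diag x : chain_class (edge x x) = 0.
Proof.
apply/class_eq0P; exists (tri x x x).
by rewrite boundary_tri !starxx subrr add0r.
Qed.

End DegreeOne.

Section DegreeOneMap.
Variables (X Y : spindleType) (u : X -> Y).
Lemma chain_map_edge x y : chain_map u (edge x y) = edge (u x) (u y).
Proof. by rewrite /edge chain_mapU; congr << _ >>; apply: val_inj. Qed.
End DegreeOneMap.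

(** * Block spindles with a one-element block *)

Section OneElementBlock.
Variables (J : choiceType) (X : J -> choiceType) (f : forall j, X j -> X j).
Variables (j0 : J) (b : X j0).
Hypothesis bE : forall x : X j0, x = b.

Local Notation B := (block_spindle f).
Local Notation I := {j : J | j != j0}.
Local Notation R := (rank_index (fun i : I => @f (val i))).

Definition base : B := Tagged X b.

Definition block_map (x : B) : B := Tagged X (f (tagged x)).

Lemma tag_star (x y : B) : tag (star x y) = tag y.
Proof. exact: tag_block_star. Qed.

Lemma starE (x y : B) :
  star x y = if tag x == tag y then y else block_map y.
Proof. by []. Qed.

Lemma tag_base (x : B) : tag x = j0 -> x = base.
Proof. by case: x => j x /= jj0; move: x; rewrite jj0 => x; rewrite (bE x). Qed.

Lemma star_neq (x y : B) : tag x != tag y -> star x y = block_map y.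
Proof. by rewrite starE => /negPf ->. Qed.

Lemma block_map_base : block_map base = base.
Proof. by rewrite /block_map (bE (f _)). Qed.

Lemma star_base (x : B) : star x base = base.
Proof. by apply: tag_base; rewrite tag_star. Qed.

Section Collapse.
Variables (P : pred J) (Pj0 : P j0).

Definition collapse (x : B) : blocks f P := insubd (Sub base Pj0) x.

Lemma val_collapse x : val (collapse x) = if P (tag x) then x else base.
Proof. by rewrite val_insubd. Qed.

(** A product lies in the block of its second factor and depends on the first one
    only through its block; collapsing does not change whether x and y share a
    block, unless y is sent to the base point, in which case both sides are
    the base point. *)
Lemma collapseM : {morph collapse : x y / star x y}.
Proof.
move=> x y; apply: val_inj; rewrite /= !val_collapse tag_star.
case: ifP => Py; last by rewrite star_base.
case: ifP => // Px; rewrite !starE /=.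
have [xy|_] := eqVneq (tag x) (tag y); first by rewrite xy Py in Px.
have [j0y|//] := eqVneq j0 (tag y).
by rewrite (tag_base (esym j0y)) block_map_base.
Qed.

Definition inclusion : blocks f P -> B := val.

Lemma inclusionM : {morph inclusion : x y / star x y}.
Proof. by []. Qed.

End Collapse.
Arguments inclusion : clear implicits.

(** The boundary of (b, x, y) is (x, y) - (f x, y) + (w, w), where w is the common
    value of b * y and x * y. *)
Lemma class_edge_block_map (x y : B) :
  tag x != tag y -> chain_class (edge (block_map x) y) = chain_class (edge x y).
Proof.
move=> xy; have [xj0|xj0] := eqVneq (tag x) j0.
  by rewrite (tag_base xj0) block_map_base.
have bx : star base x = block_map x.
  by rewrite starE /= eq_sym (negPf xj0).
have := class_boundary (tri base x y); rewrite boundary_tri bx.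
rewrite (_ : star base y = star x y); last first.
  rewrite !starE /= (negPf xy); have [yj0|//] := eqVneq j0 (tag y).
  by rewrite (tag_base (esym yj0)) block_map_base.
rewrite raddfD raddfB /= class_diag addr0 => /eqP.
by rewrite subr_eq0 => /eqP.
Qed.

Lemma class_edge_connected (i : J) (x x' : X i) (y : B) :
  i != tag y -> connected (@f i) x x' ->
  chain_class (edge (Tagged X x : B) y) =
  chain_class (edge (Tagged X x' : B) y).
Proof.
move=> iy /asboolP.
elim=> {x x'} [x _ ->|//|x x' _ -> //|x x' x'' _ -> _ -> //].
by rewrite (class_edge_block_map (x := Tagged X x)).
Qed.

(** Again the boundary of (b, x, y), which now is (x, y) - (f x, y) + (f y, y). *)
Lemma class_edge_same (x y : B) : tag x = tag y ->
  chain_class (edge (block_map x) y) =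
  chain_class (edge x y) + chain_class (edge (block_map y) y).
Proof.
move=> xy; have [yj0|yj0] := eqVneq (tag y) j0.
  rewrite (tag_base yj0) (@tag_base x) ?xy //.
  by rewrite block_map_base class_diag addr0.
have := class_boundary (tri base x y); rewrite boundary_tri.
rewrite !(@star_neq base) ?xy 1?eq_sym // (starE x y) xy eqxx.
rewrite raddfD raddfB /= addrAC => /eqP.
by rewrite subr_eq0 => /eqP <-.
Qed.

(** The boundary of (x, b, x). *)
Lemma class_edge_block_map_r (x : B) : chain_class (edge x (block_map x)) = 0.
Proof.
have [xj0|xj0] := eqVneq (tag x) j0.
  by rewrite (tag_base xj0) block_map_base class_diag.
have := class_boundary (tri x base x); rewrite boundary_tri.
by rewrite star_base starxx subrr add0r (@star_neq base) // eq_sym.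
Qed.

(** For y = f z, comparing [z, y] = 0 with [f z, y] = [y, y] = 0 shows that the
    increment [f y, y] of [class_edge_same] vanishes; so [x, y] is constant
    along the component of y, where it takes the value [y, y] = 0. *)
Lemma class_edge_image (i : J) (x z : X i) : connected (@f i) x (f z) ->
  chain_class (edge (Tagged X x : B) (Tagged X (f z))) = 0.
Proof.
set y : B := Tagged X (f z).
have yy : chain_class (edge (block_map y) y) = 0.
  have := class_edge_same (x := Tagged X z) (y := y) erefl.
  rewrite [edge (block_map _) _](_ : _ = edge y y) //.
  by rewrite (@class_edge_block_map_r (Tagged X z)) class_diag add0r.
move=> /asboolP xz; rewrite -[RHS](class_diag y) /y.
suff step x1 x2 : clos_refl_sym_trans (X i) (fun u v => v = f u) x1 x2 ->
    chain_class (edge (Tagged X x1 : B) y) =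
    chain_class (edge (Tagged X x2 : B) y).
  exact: step.
elim=> {xz x1 x2} [x1 _ ->|//|x1 x2 _ -> //|x1 x2 x3 _ -> _ -> //].
have := class_edge_same (x := Tagged X x1) (y := y) erefl.
by rewrite yy addr0 => <-.
Qed.

(** * The crossing part *)

(** Pairs of blocks one of which is the base block are left out: they occur in a
    subspindle X_i^+. *)
Definition crossing (i j : J) := [&& i != j0, j != j0 & i != j].

Lemma crossing_l i j : crossing i j -> i != j0. Proof. by case/and3P. Qed.
Lemma crossing_r i j : crossing i j -> j != j0. Proof. by case/and3P. Qed.
Lemma crossing_neq i j (h : crossing i j) :
  Sub i (crossing_l h) != Sub j (crossing_r h) :> I.
Proof. by rewrite -val_eqE /=; have /and3P[] := h. Qed.

Definition crossing_index i j (h : crossing i j) (x : X i) (y : X j) : R :=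
  existT _
   (Sub (Sub i (crossing_l h), Sub j (crossing_r h)) (crossing_neq h))
   (\pi_(components (@f i)) x, y).

(** The index of the free summand carries proofs that the two blocks differ from
    each other and from the base block; they come from deciding [crossing]. *)
Definition crossing_term (x y : B) : {freeg R} :=
  match @idP (crossing (tag x) (tag y)) with
  | ReflectT h => << crossing_index h (tagged x) (tagged y) >>
  | ReflectF _ => 0
  end.

Lemma crossing_term0 x y :
  ~~ crossing (tag x) (tag y) -> crossing_term x y = 0.
Proof. by move=> /negP nc; rewrite /crossing_term; case: {-}_ / idP. Qed.

Lemma crossing_termE x y (h : crossing (tag x) (tag y)) :
  crossing_term x y = << crossing_index h (tagged x) (tagged y) >>.
Proof.
rewrite /crossing_term; case: {-}_ / idP => // h'.
by rewrite (bool_irrelevance h' h).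
Qed.

Lemma crossing_term_block_map x y :
  crossing_term (block_map x) y = crossing_term x y.
Proof.
have [h|nh] := boolP (crossing (tag x) (tag y)); last first.
  by rewrite !crossing_term0.
rewrite (crossing_termE h) (@crossing_termE (block_map x) y h).
rewrite /crossing_index /=.
rewrite (_ : \pi_(components (@f (tag x))) (f (tagged x)) =
   \pi_(components (@f (tag x))) (tagged x)) //.
by apply/eqmodP/asboolP/rst_sym/rst_step.
Qed.

Definition crossing_part : chain B 1 -> {freeg R} :=
  fglift (fun t : 2.-tuple B => crossing_term (tnth t ord0) (tnth t ord_max)).

HB.instance Definition _ :=
  GRing.isZmodMorphism.Build (chain B 1) {freeg R} crossing_part
   (lift_is_additive _).

Lemma crossing_part_edge x y : crossing_part (edge x y) = crossing_term x y.
Proof. exact: fgliftU. Qed.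

(** In the boundary of (x, y, z) the edge (x * z, y * z) lies in one block, and
    the other two edges (y, z) and (x * y, z) agree up to moving the first
    entry inside its component. *)
Lemma crossing_part_boundary c : crossing_part (boundary c) = 0.
Proof.
have := @eq_additive _ _ (crossing_part \o boundary (n:=1)) \0.
apply=> t /=.
rewrite [t]tuple3E boundary_tri raddfD raddfB /= !crossing_part_edge.
set x := tnth t ord0; set y := tnth t (inord 1); set z := tnth t ord_max.
rewrite [X in _ + X]crossing_term0; last first.
  by rewrite /crossing !tag_star eqxx !andbF.
by rewrite addr0 starE; case: ifP => _; rewrite ?crossing_term_block_map subrr.
Qed.

Definition rank_src (r : R) : B := Tagged X (repr (tagged r).1).
Definition rank_tgt (r : R) : B := Tagged X (tagged r).2.

Lemma rank_crossing r : crossing (tag (rank_src r)) (tag (rank_tgt r)).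
Proof.
rewrite /crossing /=; case: r => [[[i j] /= ij] _] /=.
by rewrite (valP i) (valP j) ij.
Qed.

Lemma crossing_term_rank r : crossing_term (rank_src r) (rank_tgt r) = << r >>.
Proof.
rewrite (crossing_termE (rank_crossing r)); congr << _ >>.
move: (rank_crossing r); rewrite /rank_src /rank_tgt.
case: r => [[[[i hi] [j hj]] ij] [c y]] /= h; rewrite /crossing_index reprK.
move: (crossing_neq h) => ij'.
move: (crossing_l h) (crossing_r h) ij' => hi' hj'.
rewrite (bool_irrelevance hi' hi) (bool_irrelevance hj' hj) => ij'.
by rewrite (bool_irrelevance ij' ij).
Qed.

(** The terms with b make the chain a cycle and make every retraction onto a
    subspindle X_i^+ kill it modulo boundaries. *)
Definition rank_cycle (r : R) : chain B 1 :=
  edge (rank_src r) (rank_tgt r) - edge base (rank_tgt r)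
  - edge (rank_src r) base.

Definition rank_section : {freeg R} -> chain B 1 := fglift rank_cycle.

HB.instance Definition _ :=
  GRing.isZmodMorphism.Build {freeg R} (chain B 1) rank_section
   (lift_is_additive _).

Lemma rank_sectionU r : rank_section << r >> = rank_cycle r.
Proof. exact: fgliftU. Qed.

Lemma boundary_rank_section w : boundary (rank_section w) = 0.
Proof.
have := @eq_additive _ _ (boundary (n:=0) \o rank_section) \0.
apply=> r /=.
rewrite rank_sectionU !raddfB /= !boundary_edge star_base subrr subr0.
have /and3P[_ jj0 ij] := rank_crossing r.
by rewrite (star_neq ij) (@star_neq base) 1?eq_sym // subrr.
Qed.

Lemma crossing_part_rank_section w : crossing_part (rank_section w) = w.
Proof.
have := @eq_additive _ _ (crossing_part \o rank_section) idfun.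
apply=> r /=; rewrite rank_sectionU !raddfB /= !crossing_part_edge.
rewrite crossing_term_rank !crossing_term0 ?subr0 //;
  by rewrite /crossing /= eqxx ?andbF.
Qed.

(** * The retractions onto the subspindles of two blocks *)

Definition pair_block (i : I) : pred J := pred2 (val i) j0.
Local Notation Bplus i := (blocks f (pair_block i)).

Lemma pair_block_base i : pair_block i j0.
Proof. by rewrite /pair_block /= eqxx orbT. Qed.

Definition retract i : B -> Bplus i := collapse (pair_block_base i).

Lemma retractM i : {morph retract i : x y / star x y}.
Proof. exact: collapseM. Qed.

(** The retraction followed by the inclusion.  The base block falls under the
    second branch, its only point being [base]. *)
Definition retract_val (i : I) (x : B) : B :=
  if tag x == val i then x else base.

Lemma val_retract i x : val (retract i x) = retract_val i x.
Proof.
rewrite val_collapse /retract_val /pair_block /= /in_mem /=.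
case: eqVneq => //= _.
by have [/tag_base|] := eqVneq (tag x) j0.
Qed.

Lemma retract_base i x : tag x != val i -> retract i x = retract i base.
Proof.
move=> xi; apply: val_inj; rewrite !val_retract /retract_val (negPf xi).
by case: ifP.
Qed.

Definition block_part (i : I) (z : chain B 1) : chain B 1 :=
  chain_map (inclusion _) (chain_map (retract i) z).

Lemma block_part_is_zmod_morphism i : zmod_morphism (block_part i).
Proof. by move=> u v; rewrite /block_part !raddfB. Qed.
HB.instance Definition _ i :=
  GRing.isZmodMorphism.Build (chain B 1) (chain B 1) (block_part i)
   (block_part_is_zmod_morphism i).

Lemma block_part_edge i x y :
  block_part i (edge x y) = edge (retract_val i x) (retract_val i y).
Proof. by rewrite /block_part !chain_map_edge /inclusion !val_retract. Qed.

(** The identity of the chains modulo boundaries is the sum of the section of the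
    crossing part and of the retractions.  For x and y in one block, only the
    retraction onto that block sees the edge.  For x and y in two blocks, the
    retractions onto them give [x, b] and [b, y], and the rest of [x, y] is
    the class of the crossing cycle. *)
Lemma class_edge_decomposition (S : seq I) (x y : B) : uniq S ->
  (forall i : I, val i = tag x -> i \in S) ->
  (forall i : I, val i = tag y -> i \in S) ->
  chain_class (edge x y) = chain_class (rank_section (crossing_term x y))
     + \sum_(i <- S) chain_class (block_part i (edge x y)).
Proof.
move=> uS Sx Sy.
have sumS j (c : coker B 1) : (j = j0 -> c = 0) ->
    (forall i : I, val i = j -> i \in S) ->
    \sum_(i <- S) (if j == val i then c else 0) = c.
  move=> cj0 Sj; have [jj0|jj0] := eqVneq j j0.
    by rewrite cj0 // big1 // => i _; case: ifP.
  rewrite (bigD1_seq (Sub j jj0)) ?Sj //= eqxx big1 ?addr0 // => i.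
  by rewrite -val_eqE /= eq_sym => /negPf ->.
have [xy|xy] := eqVneq (tag x) (tag y).
  rewrite crossing_term0; last by rewrite /crossing xy eqxx !andbF.
  rewrite !raddf0 add0r -[LHS](@sumS (tag x)) //; last first.
    by move=> xj0; rewrite (tag_base xj0) (@tag_base y) -?xy // class_diag.
  apply: eq_bigr => i _; rewrite block_part_edge /retract_val -xy.
  by case: ifP => // _; rewrite class_diag.
have -> : \sum_(i <- S) chain_class (block_part i (edge x y)) =
    chain_class (edge x base) + chain_class (edge base y).
  rewrite -(sumS (tag x) (chain_class (edge x base))) // => [|/tag_base ->];
    last exact: class_diag.
  rewrite -(sumS (tag y) (chain_class (edge base y))) // => [|/tag_base ->];
    last exact: class_diag.
  rewrite -big_split /=; apply: eq_bigr => i _.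
  rewrite block_part_edge /retract_val.
  have [xi|xi] := eqVneq (tag x) (val i).
    by rewrite (_ : tag y == val i = false) ?addr0 // -xi eq_sym (negPf xy).
  by case: ifP => _; rewrite ?class_diag add0r.
case: (boolP (crossing (tag x) (tag y))) => [h|nh].
  rewrite (crossing_termE h) rank_sectionU /rank_cycle !raddfB /=.
  have /and3P[xj0 _ _] := h.
  have rx : connected (@f (tag x))
      (repr (\pi_(components (@f (tag x))) (tagged x))) (tagged x).
    by apply/eqmodP; rewrite reprK.
  rewrite /rank_src /rank_tgt /= (class_edge_connected _ rx) //.
  rewrite (class_edge_connected (y := base) _ rx) //.
  case: x y {xy h uS Sx Sy rx xj0} => [i x] [j y] /=.
  by rewrite -addrA addKr subrK.
rewrite crossing_term0 // !raddf0 add0r.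
move: nh; rewrite /crossing xy andbT negb_and !negbK => /orP[]/eqP/tag_base ->.
  by rewrite class_diag add0r.
by rewrite class_diag addr0.
Qed.

Definition block_support (z : chain B 1) : seq I :=
  undup (pmap insub [seq tag (tnth t k) | t <- dom z, k <- enum 'I_2]).

Lemma mem_block_support z t k (i : I) :
  t \in dom z -> val i = tag (tnth t k) -> i \in block_support z.
Proof.
move=> zt it; rewrite mem_undup mem_pmap_sub it; apply/allpairsP; exists (t, k).
by rewrite mem_enum.
Qed.

Lemma class_decomposition z :
  chain_class z = chain_class (rank_section (crossing_part z))
     + \sum_(i <- block_support z) chain_class (block_part i z).
Proof.
set S := block_support z.
pose g2 z := chain_class (rank_section (crossing_part z))
     + \sum_(i <- S) chain_class (block_part i z).
have g2_additive : zmod_morphism g2.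
  move=> u v; rewrite /g2 !raddfB /= opprD addrACA; congr (_ + _).
  by rewrite -sumrB; apply: eq_bigr => i _; rewrite !raddfB.
pose g2A := GRing.isZmodMorphism.Build _ _ g2 g2_additive.
apply: (@eq_additive_dom _ _ (chain_class (n:=1))
  (HB.pack_for {additive chain B 1 -> coker B 1} g2 g2A)) => t zt /=.
rewrite [t]tuple2E /g2 crossing_part_edge.
apply: class_edge_decomposition; first exact: undup_uniq.
  by move=> i; apply: mem_block_support.
by move=> i; apply: mem_block_support.
Qed.

Lemma class_retract_outside z i :
  i \notin block_support z -> chain_class (chain_map (retract i) z) = 0.
Proof.
move=> iz.
apply: (@eq_additive_dom _ _
  (chain_class (n:=1) \o chain_map (n:=1) (retract i)) \0) => t zt /=.
rewrite [t]tuple2E -/(edge _ _) chain_map_edge.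
have out k : tag (tnth t k) != val i.
  by apply: contraNneq iz => ti; apply: (mem_block_support zt (esym ti)).
by rewrite /inclusion !(retract_base (out _)) class_diag.
Qed.

Lemma class_retract_rank_section i w :
  chain_class (chain_map (retract i) (rank_section w)) = 0.
Proof.
have := @eq_additive _ _
  (chain_class (n:=1) \o (chain_map (n:=1) (retract i) \o rank_section)) \0.
apply=> r /=; rewrite rank_sectionU !raddfB /= !chain_map_edge.
have /and3P[_ _ ij] := rank_crossing r.
have [ki|ki] := eqVneq (tag (rank_tgt r)) (val i).
  rewrite (@retract_base i (rank_src r)) ?class_diag -?ki //.
  by rewrite subrr subr0.
by rewrite (retract_base ki) class_diag subr0 subrr.
Qed.

Lemma crossing_part_sub i (u : chain (Bplus i) 1) :
  crossing_part (chain_map (inclusion _) u) = 0.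
Proof.
have := @eq_additive _ _
  (crossing_part \o chain_map (n:=1) (inclusion (pair_block i))) \0.
apply=> t /=; rewrite [t]tuple2E -/(edge _ _) chain_map_edge crossing_part_edge.
apply: crossing_term0; rewrite /crossing /inclusion.
have /orP[/eqP->|/eqP->] := valP (tnth t ord0); last by rewrite eqxx.
by have /orP[/eqP->|/eqP->] := valP (tnth t ord_max); rewrite eqxx ?andbF.
Qed.

Lemma class_retract_sub i k (u : chain (Bplus k) 1) : k != i ->
  chain_class (chain_map (retract i) (chain_map (inclusion _) u)) = 0.
Proof.
move=> ki.
have := @eq_additive _ _ (chain_class (n:=1) \o
  (chain_map (n:=1) (retract i) \o
   chain_map (n:=1) (inclusion (pair_block k)))) \0.
apply=> t /=; rewrite [t]tuple2E -/(edge _ _) !chain_map_edge.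
have out (x : Bplus k) : tag (val x) != val i.
  have /orP[/eqP->|/eqP->] := valP x; first by rewrite val_eqE.
  by rewrite eq_sym (valP i).
by rewrite /inclusion !(retract_base (out _)) class_diag.
Qed.

Lemma retract_sub i (u : chain (Bplus i) 1) :
  chain_map (retract i) (chain_map (inclusion _) u) = u.
Proof.
have := @eq_additive _ _ (chain_map (n:=1) (retract i) \o
  chain_map (n:=1) (inclusion (pair_block i))) idfun.
apply=> t /=; rewrite [t]tuple2E -/(edge _ _) !chain_map_edge.
have fix_ (x : Bplus i) : retract i (val x) = x.
  by apply: val_inj; rewrite val_collapse (valP x).
by rewrite /inclusion !fix_.
Qed.

Local Notation S := (dsum (fun i : I => homology (Bplus i) 1)).

Definition retract_classes (z : cycles B 1) :
    dprod (fun i : I => homology (Bplus i) 1) :=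
  fun i => homology_class (cycles_map (retractM i) z).

Lemma retract_classes_finsupp z : finsupp (retract_classes z).
Proof.
apply/asboolP; apply: sub_finite_set (finite_seq (block_support (val z))).
move=> i /= zi; apply: contrapT => /negP iz; apply: zi.
by apply/homology_class_eq0P; rewrite /= class_retract_outside.
Qed.

Definition split_cycle (z : cycles B 1) : {freeg R} * S :=
  (crossing_part (val z), Sub (retract_classes z) (retract_classes_finsupp z)).

Lemma split_cycle_is_zmod_morphism : zmod_morphism split_cycle.
Proof.
move=> z w; congr (_, _); first by rewrite /= !raddfB.
apply: val_inj; apply: functional_extensionality_dep => i.
by rewrite /= /retract_classes !raddfB.
Qed.
HB.instance Definition _ :=
  GRing.isZmodMorphism.Build (cycles B 1) ({freeg R} * S)%type split_cycle
   split_cycle_is_zmod_morphism.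

Lemma split_cycle_eq0 z : split_cycle z = 0 <-> chain_class (val z) = 0.
Proof.
split=> [[z0 zi]|z0].
  rewrite class_decomposition z0 !raddf0 add0r big1 // => i _.
  apply: class_chain_map; first exact: inclusionM.
  have : retract_classes z i = 0 by rewrite zi.
  by move/homology_class_eq0P.
congr (_, _).
  by have /class_eq0P[c <-] := z0; rewrite crossing_part_boundary.
apply: val_inj; apply: functional_extensionality_dep => i.
by apply/homology_class_eq0P; apply: class_chain_map; first exact: retractM.
Qed.

(** A preimage of (w, u) is the crossing cycle of w plus the cycles u_i included
    from the finitely many X_i^+ with u_i nonzero: the crossing part does not
    see the latter, the retractions do not see the former, and the retraction
    onto X_k^+ kills what comes from X_i^+ for i <> k. *)
Lemma split_cycle_surj v : exists z, split_cycle z = v.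
Proof.
case: v => w u.
have /asboolP/finite_seqP[s0 us0] := valP u.
pose s := undup s0.
pose ui i : cycles (Bplus i) 1 := repr (val u i).
pose zc : cycles B 1 :=
  Sub (rank_section w) (introT eqP (boundary_rank_section w)).
exists (zc + \sum_(i <- s) cycles_map (@inclusionM (pair_block i)) (ui i)).
congr (_, _).
  rewrite !raddfD !raddf_sum /= crossing_part_rank_section.
  rewrite big1 ?addr0 // => i _.
  exact: crossing_part_sub.
apply: val_inj; apply: functional_extensionality_dep => k /=.
rewrite /retract_classes !raddfD !raddf_sum /=.
rewrite (_ : homology_class (cycles_map (retractM k) zc) = 0); last first.
  exact/homology_class_eq0P/class_retract_rank_section.
rewrite add0r.
have other i : i != k ->
    homology_class (cycles_map (retractM k)
      (cycles_map (@inclusionM (pair_block i)) (ui i))) = 0.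
  by move=> ik; apply/homology_class_eq0P/class_retract_sub.
have [ks|ks] := boolP (k \in s).
  rewrite (bigD1_seq k) ?undup_uniq //= big1 ?addr0; last first.
    by move=> i; apply: other.
  rewrite -[RHS]reprK; congr homology_class; apply: val_inj.
  exact: retract_sub.
rewrite big1_seq; last first.
  by move=> i /= si; apply: other; apply: contraNneq ks => <-.
apply: contrapT => uk; move/negP: ks; apply; rewrite mem_undup.
have : [set i | val u i <> 0]%classic k.
  by move=> /= uk0; apply: uk; rewrite uk0.
by rewrite us0.
Qed.

Lemma homology_decomposition :
  zmod_isomorphic (homology B 1) ({freeg R} * S)%type.
Proof.
have [g gE] :=
  homology_lift (g := split_cycle) (fun z => proj2 (split_cycle_eq0 z)).
apply: (proj1 (@zmod_isomorphic_of_bij _ _ g _ _)) => [h|v].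
  have [z ->] := homology_class_surj h; rewrite gE.
  by move/split_cycle_eq0/homology_class_eq0P.
by have [z <-] := split_cycle_surj v; exists (homology_class z).
Qed.

End OneElementBlock.

(** * Finite abelian groups as torsion subgroups *)

(** The decomposition into an internal direct product of cyclic groups, in additive
    notation. *)
Lemma finite_abelian_basis (A : finZmodType) :
  exists m (a : 'I_m -> A),
    (forall x, exists k : 'I_m -> nat, x = \sum_i a i *+ k i) /\
    (forall k : 'I_m -> int, \sum_i a i *~ k i = 0 ->
       forall i, exists q : int, k i = #[a i]%g%:Z * q).
Proof.
have [s sA _] := abelian_structure (FinRing.zmod_abelian [set: A]).
rewrite big_tnth in sA.
exists (size s), (tnth (in_tuple s)); set a := tnth _.
split=> [x|k k0 i].
  have [c [ca -> _]] := mem_bigdprod sA (finset.in_setT x).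
  have /fin_all_exists[k kc] i : exists k, c i = a i *+ k.
    by have /cycleP[k ->] := ca i isT; exists k.
  by exists k; apply: eq_bigr => i _.
have [c [ca c0 cu]] := mem_bigdprod sA (finset.in_setT 0).
have mem_zmul j : a j *~ k j \in (<[a j]>)%g.
  by case: (k j) => l; rewrite -?pmulrn ?NegzE ?mulrNz ?groupV mem_cycle.
have k1 : a i *~ k i = 0.
  rewrite (cu _ (fun j _ => mem_zmul j) (esym k0) i isT).
  by rewrite -(cu (fun=> 0) (fun j _ => group1 _) _ i isT) // big1_eq.
suff /dvdzP[q ->] : (#[a i]%g%:Z %| k i)%Z by exists q; rewrite mulrC.
rewrite dvdzE absz_nat order_dvdn FinRing.zmodXgE; apply/eqP.
move: k1; case: (k i) => l /=; first by [].
by rewrite NegzE mulrNz => /eqP; rewrite oppr_eq0 => /eqP.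
Qed.

Section Realization.
Variables (A : finZmodType) (m : nat) (a : 'I_m -> A).
Hypothesis a_gen : forall x, exists k : 'I_m -> nat, x = \sum_i a i *+ k i.
Hypothesis a_free : forall k : 'I_m -> int, \sum_i a i *~ k i = 0 ->
  forall i, exists q : int, k i = #[a i]%g%:Z * q.

(** The blocks are numbered by the basis, together with one more index [None] for
    the one-element block; the latter is the case of period 0 below. *)
Definition period (j : option 'I_m) : nat :=
  if j is Some i then #[a i]%g else 0.

Definition tailed_cycle (j : option 'I_m) : choiceType := 'I_(period j).+1.

(** The tail 0 leads to the cycle 1 -> 2 -> ... -> period -> 1.  In period 0 the
    value 1 is out of range, where [inord] falls back to 0. *)
Definition next j (x : tailed_cycle j) : tailed_cycle j :=
  inord (if (x < period j)%N then x.+1 else 1%N).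

Local Notation B := (block_spindle next).

Definition vertex j (k : nat) : B :=
  Tagged tailed_cycle (inord k : 'I_(period j).+1).

Lemma base_unique (x : tailed_cycle None) : x = ord0.
Proof. exact: ord1. Qed.

Local Notation basepoint := (@base _ _ next None ord0).

Definition pos (x : B) : nat := tagged x : 'I_(period (tag x)).+1.

Lemma pos_le x : (pos x <= period (tag x))%N.
Proof. by rewrite -ltnS /pos ltn_ord. Qed.

Lemma pos_vertex j k : (k <= period j)%N -> pos (vertex j k) = k.
Proof. by move=> kj; rewrite /pos /= inordK. Qed.

Lemma vertex_pos (x : B) : vertex (tag x) (pos x) = x.
Proof. by case: x => j x; rewrite /vertex /pos /= inord_val. Qed.

Lemma pos_block_map (x : B) : tag x != None ->
  pos (block_map x) = if (pos x < period (tag x))%N then (pos x).+1 else 1%N.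
Proof.
case: x => [[i|//] x] _; rewrite /block_map /pos /= /next /= inordK //.
by case: ifP => // _; rewrite ltnS order_gt0.
Qed.

Lemma block_map_vertex (i : 'I_m) k : (k < #[a i]%g)%N ->
  block_map (vertex (Some i) k) = vertex (Some i) k.+1.
Proof.
move=> ki; rewrite -[LHS]vertex_pos pos_block_map // pos_vertex /= ?ki //.
exact: ltnW.
Qed.

Lemma connected_vertex0 j (x : tailed_cycle j) :
  connected (@next j) x (inord 0 : 'I_(period j).+1).
Proof.
rewrite -[x]inord_val; have : (x <= period j)%N by rewrite -ltnS ltn_ord.
elim: (x : nat) => [|k IHk] kj; first exact/asboolP/rst_refl.
apply/asboolP; apply: rst_trans; last by apply/asboolP/IHk/ltnW.
apply/rst_sym/rst_step; rewrite /next inordK ?kj //.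
by rewrite ltnS ltnW.
Qed.

(** Every block being connected, the classes of edges between two different blocks
    are determined by the block of the first end and by the second end. *)
Definition cross_term (x y : B) : {freeg (option 'I_m * B)%type} :=
  if tag x == tag y then 0 else << (tag x, y) >>.

Definition cross_part : chain B 1 -> {freeg (option 'I_m * B)%type} :=
  fglift (fun t : 2.-tuple B => cross_term (tnth t ord0) (tnth t ord_max)).
HB.instance Definition _ :=
  GRing.isZmodMorphism.Build (chain B 1) {freeg (option 'I_m * B)%type}
    cross_part (lift_is_additive _).

Lemma cross_part_edge x y : cross_part (edge x y) = cross_term x y.
Proof. exact: fgliftU. Qed.

Lemma cross_part_boundary c : cross_part (boundary c) = 0.
Proof.
have := @eq_additive _ _ (cross_part \o boundary (n:=1)) \0.
apply=> t /=; rewrite [t]tuple3E boundary_tri raddfD raddfB /= !cross_part_edge.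
by rewrite /cross_term !tag_star eqxx subrr addr0.
Qed.

Definition cross_section : {freeg (option 'I_m * B)%type} -> chain B 1 :=
  fglift (fun jy : option 'I_m * B => edge (vertex jy.1 0) jy.2).
HB.instance Definition _ :=
  GRing.isZmodMorphism.Build {freeg (option 'I_m * B)%type} (chain B 1)
    cross_section (lift_is_additive _).

Lemma cross_sectionU jy : cross_section << jy >> = edge (vertex jy.1 0) jy.2.
Proof. exact: fgliftU. Qed.

(** The number of steps from the tail to x, as an integer: modulo the length of the
    cycle it is the coefficient of the edge from x to the tail on the torsion
    class of the block. *)
Definition winding_term (i : 'I_m) (x y : B) : int^o :=
  if (y == vertex (Some i) 0) && (tag x == Some i) then (pos x)%:Z else 0.

Definition winding (i : 'I_m) : chain B 1 -> int^o :=
  fglift (fun t : 2.-tuple B =>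
    winding_term i (tnth t ord0) (tnth t ord_max)).
HB.instance Definition _ i :=
  GRing.isZmodMorphism.Build (chain B 1) int^o (winding i)
   (lift_is_additive _).

Lemma winding_edge i x y : winding i (edge x y) =
  if (y == vertex (Some i) 0) && (tag x == Some i) then (pos x)%:Z else 0.
Proof. exact: fgliftU. Qed.

Definition loop (i : 'I_m) : chain B 1 :=
  edge (vertex (Some i) 1) (vertex (Some i) 0).

Lemma boundary_loop i : boundary (loop i) = 0.
Proof. by rewrite boundary_edge starE eqxx subrr. Qed.

(** Each step of the first end adds the class of the edge from the image of the
    tail to the tail, which is the loop. *)
Lemma class_edge_tail i k : (k <= #[a i]%g)%N ->
  chain_class (edge (vertex (Some i) k) (vertex (Some i) 0)) =
  chain_class (loop i) *+ k.
Proof.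
elim: k => [|k IHk] ki; first by rewrite class_diag.
rewrite -block_map_vertex // (class_edge_same base_unique) //.
rewrite block_map_vertex ?order_gt0 //.
by rewrite IHk ?mulrSr // ltnW.
Qed.

(** The last vertex of the cycle and the tail have the same image, so the step
    relation for both compares n times the loop with 0 times the loop. *)
Lemma class_loop_torsion i : chain_class (loop i) *+ #[a i]%g = 0.
Proof.
rewrite -class_edge_tail //.
set x := vertex (Some i) #[a i]%g; set y := vertex (Some i) 0.
have ax : block_map x = block_map y.
  rewrite [RHS]block_map_vertex ?order_gt0 //.
  rewrite -[LHS]vertex_pos pos_block_map // pos_vertex //.
  by rewrite ltnn.
have := class_edge_same base_unique (x := x) (y := y) erefl.
by rewrite ax -[LHS]add0r => /addIr <-.
Qed.

(** Modulo boundaries the chains are the sum of a free group, on the edges between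
    different blocks, and of the cyclic groups generated by the loops: an edge
    inside a block is a multiple of the loop if it ends at the tail, and it
    vanishes if its second end is the image of a vertex. *)
Lemma class_edge_cycle_decomposition x y :
  chain_class (edge x y) = chain_class (cross_section (cross_term x y))
    + \sum_i chain_class (loop i) *~ winding i (edge x y).
Proof.
rewrite /cross_term; have [xy|xy] := eqVneq (tag x) (tag y); last first.
  rewrite big1 ?addr0 => [|i _]; last first.
    rewrite winding_edge; case: andP => // -[/eqP yi /eqP xi].
    by rewrite xi yi /= eqxx in xy.
  rewrite cross_sectionU /=; case: x xy => [j x] /= xy.
  exact: (class_edge_connected base_unique xy (connected_vertex0 x)).
rewrite !raddf0 add0r.
case yE: (tag y) xy => [i|] xy; last first.
  rewrite (tag_base base_unique yE) (tag_base base_unique xy) class_diag.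
  by rewrite big1 // => i _; rewrite winding_edge andbF.
have [y0|y0] := eqVneq y (vertex (Some i) 0).
  rewrite (bigD1 i) //= winding_edge y0 xy !eqxx /= big1 => [|k ki]; last first.
    have ik : (Some i == Some k) = false.
      by apply/eqP => -[ik]; rewrite ik eqxx in ki.
    by rewrite winding_edge xy ik andbF.
  rewrite addr0 -{1}[x]vertex_pos xy class_edge_tail //.
  by have := pos_le x; rewrite xy.
rewrite big1 => [|k _]; last first.
  rewrite winding_edge; case: andP => // -[/eqP yk].
  by move: y0; rewrite -yE yk eqxx.
rewrite -[x]vertex_pos xy -[y]vertex_pos yE.
have ypos : (0 < pos y <= #[a i]%g)%N.
  have := pos_le y; rewrite yE => ->; rewrite lt0n andbT.
  by apply: contraNneq y0 => yp; rewrite -[y]vertex_pos yE yp.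
case: (pos y) ypos => // k /andP[_ ki].
rewrite -block_map_vertex //.
apply: (class_edge_image base_unique).
apply/asboolP; apply: rst_trans; first exact/asboolP/connected_vertex0.
exact/rst_sym/asboolP/connected_vertex0.
Qed.

Lemma class_cycle_decomposition z :
  chain_class z = chain_class (cross_section (cross_part z))
    + \sum_i chain_class (loop i) *~ winding i z.
Proof.
pose g2 z := chain_class (cross_section (cross_part z))
    + \sum_i chain_class (loop i) *~ winding i z.
have g2_additive : zmod_morphism g2.
  move=> u v; rewrite /g2 !raddfB /= opprD addrACA; congr (_ + _).
  by rewrite -sumrB; apply: eq_bigr => i _; rewrite raddfB /= mulrzBr.
pose g2A := GRing.isZmodMorphism.Build _ _ g2 g2_additive.
apply: (@eq_additive _ _ (chain_class (n:=1))
  (HB.pack_for {additive chain B 1 -> coker B 1} g2 g2A)) => t /=.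
rewrite [t]tuple2E /g2 cross_part_edge.
exact: class_edge_cycle_decomposition.
Qed.

Definition total_winding (z : chain B 1) : A := \sum_i a i *~ winding i z.
Lemma total_winding_is_zmod_morphism : zmod_morphism total_winding.
Proof.
move=> u v; rewrite /total_winding -sumrB; apply: eq_bigr => i _.
by rewrite raddfB /= mulrzBr.
Qed.
HB.instance Definition _ :=
  GRing.isZmodMorphism.Build (chain B 1) A total_winding
    total_winding_is_zmod_morphism.

Definition generator (j : option 'I_m) : A := if j is Some i then a i else 0.
Definition value (x : B) : A := generator (tag x) *+ pos x.

(** Going from the last vertex of a cycle back to the first one changes the
    position by 1 - n instead of 1, which n a_i = 0 makes up for. *)
Lemma value_block_map x : value (block_map x) = value x + generator (tag x).
Proof.
have [xN|xN] := eqVneq (tag x) None.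
  by rewrite (tag_base base_unique xN) (block_map_base _ base_unique) addr0.
rewrite /value /= pos_block_map //; case: ifP => [_|]; first by rewrite mulrSr.
case: (tag x) (pos_le x) xN => [i|//] /= xi _ /negbT; rewrite -leqNgt => ix.
rewrite (_ : pos x = #[a i]%g); last by apply/eqP; rewrite eqn_leq xi.
by rewrite (expg_order (a i) : a i *+ _ = 0) add0r.
Qed.

Lemma total_winding_edge x y :
  total_winding (edge x y) =
  if (tag x == tag y) && (pos y == 0)%N then value x else 0.
Proof.
rewrite /total_winding; case: ifP => [/andP[/eqP xy /eqP y0]|nxy].
  rewrite /value xy; case yE : (tag y) => [i|] /=.
    rewrite (bigD1 i) //= big1 => [|k ki]; last first.
      have ik : (Some i == Some k) = false.
        by apply/eqP => -[ik]; rewrite ik eqxx in ki.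
      by rewrite winding_edge xy yE ik andbF.
    by rewrite winding_edge -[y]vertex_pos xy yE y0 !eqxx addr0.
  by rewrite mul0rn big1 // => k _; rewrite winding_edge xy yE andbF.
apply: big1 => i _; rewrite winding_edge.
case: ifP => // /andP[/eqP yi /eqP xi].
by move: nxy; rewrite yi xi pos_vertex ?eqxx.
Qed.

(** In the base block all values are zero.  Elsewhere the image of a vertex is
    never a tail, so for the boundary of (x, y, z) to be seen at all, z has to be
    a tail itself, and y has to lie in the same block.  If x
    does too, nothing moves; otherwise y advances by one step, and the third
    edge (f z, z) makes up for that step. *)
Lemma total_winding_boundary c : total_winding (boundary c) = 0.
Proof.
have := @eq_additive _ _ (total_winding \o boundary (n:=1)) \0.
apply=> t /=; rewrite [t]tuple3E boundary_tri raddfD raddfB /=.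
set x := tnth t ord0; set y := tnth t (inord 1); set z := tnth t ord_max.
rewrite !total_winding_edge !tag_star eqxx /=.
have [zN|zN] := eqVneq (tag z) None.
  rewrite (tag_base base_unique zN) !(star_base base_unique).
  have -> : value basepoint = 0 by rewrite /value mul0rn.
  have -> : pos basepoint = 0%N by [].
  rewrite eqxx andbT addr0; case: ifP => [/eqP/(tag_base base_unique) ->|_].
    by rewrite (star_base base_unique) subrr.
  by rewrite subrr.
have bz : (pos (block_map z) == 0)%N = false.
  by rewrite pos_block_map //; case: ifP.
rewrite (starE y z); case: (eqVneq (tag y) (tag z)) => yz /=; last first.
  by rewrite bz addr0 subrr.
case: (eqVneq (pos z) 0%N) => z0; last by rewrite addr0 subrr.
rewrite !starE -yz; case: (eqVneq (tag x) (tag y)) => xy.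
  by rewrite subrr add0r /value z0.
rewrite !value_block_map -yz /value z0 mulr0n add0r.
by rewrite opprD addNKr addNr.
Qed.

Lemma total_winding_loop i : total_winding (loop i) = a i.
Proof.
by rewrite total_winding_edge eqxx /value !pos_vertex ?eqxx // order_gt0.
Qed.

(** A torsion class has no component in the free part, and a vanishing total
    winding number makes each coefficient of a loop a multiple of its order. *)
Lemma torsion_total_winding_eq0 n (z : chain B 1) : (0 < n)%N ->
  chain_class z *+ n = 0 -> total_winding z = 0 -> chain_class z = 0.
Proof.
move=> n0 zn wz.
have cz : cross_part z = 0.
  apply: (freeg_torsion_free n0).
  rewrite -raddfMn; move: zn; rewrite -raddfMn => /class_eq0P[c <-].
  exact: cross_part_boundary.
rewrite class_cycle_decomposition cz !raddf0 add0r big1 // => i _.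
have [q ->] := a_free wz i.
by rewrite mulrzA -pmulrn class_loop_torsion mul0rz.
Qed.

Definition loop_cycle i : cycles B 1 :=
  Sub (loop i) (introT eqP (boundary_loop i)).

Lemma loop_torsion i : is_torsion (homology_class (loop_cycle i)).
Proof.
apply/asboolP; exists #[a i]%g; rewrite ?order_gt0 // -raddfMn.
by apply/homology_class_eq0P; rewrite !raddfMn /= class_loop_torsion.
Qed.

Lemma torsion_homology : zmod_isomorphic A (torsion (homology B 1)).
Proof.
have w0 (z : cycles B 1) :
    chain_class (val z) = 0 -> (total_winding \o val) z = 0.
  by move=> /class_eq0P[c /= <-]; exact: total_winding_boundary.
have [g gE] := homology_lift w0.
apply: (proj2 (@zmod_isomorphic_of_bij _ _ (g \o val) _ _)) => [h|x].
  have [z hz] := homology_class_surj (val h).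
  have /asboolP[n n0] := valP h.
  rewrite /= hz gE -raddfMn => /homology_class_eq0P.
  rewrite !raddfMn /= => zn wz.
  apply: val_inj; rewrite hz; apply/homology_class_eq0P.
  exact: torsion_total_winding_eq0 n0 zn wz.
have [k ->] := a_gen x.
have ht : is_torsion (\sum_i homology_class (loop_cycle i) *+ k i).
  by apply: rpred_sum => i _; apply: rpredMn; apply: loop_torsion.
exists (Sub _ ht); rewrite /= raddf_sum; apply: eq_bigr => i _.
by rewrite raddfMn gE /= total_winding_loop.
Qed.

End Realization.

Theorem theorem5p4 :
  (forall (J : choiceType) (X : J -> choiceType) (f : forall j, X j -> X j)
     (j0 : J) (b : X j0),
     (forall x : X j0, x = b) ->
     let I : choiceType := {j : J | j != j0} in
     zmod_isomorphic
       (homology (block_spindle f) 1)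
       ({freeg (rank_index (fun i : I => @f (val i)))} *
        dsum (fun i : I => homology (blocks f (pred2 (val i) j0)) 1))%type)
  /\
  (forall A : finZmodType,
     exists X : spindleType, zmod_isomorphic A (torsion (homology X 1))).
Proof.
split=> [J X f j0 b bE I|A]; first exact: homology_decomposition bE.
have [m [a [a_gen a_free]]] := finite_abelian_basis A.
by exists (block_spindle (@next A m a)); apply: torsion_homology.
Qed.
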